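(* The function $t\mapsto\hat\mu(t)$, $t\in[1,\infty)$, is Lipschitz continuous with Lipschitz constant $1$.
   Context: We work over $\mathbb{C}$. For $\xi\in\mathbb{C}[[x]]$ with $\xi(0)=0$ and real $t\ge 1$, the quasimonomial valuation $v(\xi,t)$ of $\mathbb{C}(x,y)$ is given on polynomials by $f\mapsto v(\xi,t;f)=\operatorname{ord}_x f(x,\xi(x)+\theta x^t)$, $\theta$ transcendental over $\mathbb{C}$; equivalently, if $f=\sum a_{ij}x^i(y-\xi(x))^j$, then $v(\xi,t;f)=\min\{i+tj\mid a_{ij}\ne0\}$. Put $\mu_d(\xi,t)=\max\{v(\xi,t;f)\mid 0\ne f\in\mathbb{C}[x,y],\ \deg f\le d\}$ and $\hat\mu(\xi,t)=\lim_{d\to\infty}\mu_d(\xi,t)/d$. For fixed $t$, all very general series $\xi$ (coefficients of a jet outside a countable union of proper Zariski closed subsets) give the same value $\hat\mu(\xi,t)$, which is the minimum over all $\xi$; this value is denoted $\hat\mu(t)$. *)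

(* Defs.v *)
From HB Require Import structures.
From mathcomp Require Import all_boot all_order all_algebra complex.
From mathcomp Require Import all_classical all_reals all_analysis.
From mathcomp Require Import ring.
From mathcomp.multinomials Require mpoly.
Import Order.TTheory GRing.Theory Num.Theory.
Import numFieldNormedType.Exports.

Set Implicit Arguments.
Unset Strict Implicit.
Unset Printing Implicit Defensive.

Local Open Scope classical_set_scope.
Local Open Scope ring_scope.

(* The field of complex numbers is R[i] with R : realType. A series
   xi = \sum_k xi_k x^k in C[[x]] is its coefficient sequence nat -> R[i].
   A polynomial f in C[x, y] is an element of {poly {poly R[i]}}: the outer
   variable is y, the inner one is x, and f`_j`_i is the coefficient of
   x^i y^j. *)

Section Valuation.
Variable R : realType.
Implicit Types (xi : nat -> R[i]) (f : {poly {poly R[i]}}) (t : R).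

Definition total_degree_le (d : nat) f : Prop :=
  forall i j : nat, f`_j`_i != 0 -> (i + j <= d)%N.

Definition series_trunc xi (N : nat) : {poly R[i]} := \poly_(k < N) xi k.

(* The coefficient a_ij in f = \sum a_ij x^i (y - xi(x))^j, that is, the
   coefficient of x^i z^j in f(x, xi(x) + z). It only depends on xi modulo
   x^(i+1), so xi may be replaced by its truncation, which keeps the
   substitution inside polynomials; see quasi_coef_trunc. *)
Definition quasi_coef xi f (i j : nat) : R[i] :=
  (f \Po ('X + (series_trunc xi i.+1)%:P))`_j`_i.

Lemma quasi_coef_trunc xi f (i j N : nat) : (i < N)%N ->
  (f \Po ('X + (series_trunc xi N)%:P))`_j`_i = quasi_coef xi f i j.
Proof.
move=> ltiN; rewrite /quasi_coef.
set c := series_trunc xi N; set c' := series_trunc xi i.+1.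
have [w cE] : exists w, c = c' + 'X^(i.+1) * w.
  exists (drop_poly i.+1 c); rewrite [LHS](esym (poly_take_drop i.+1 c)) mulrC.
  congr (_ + _).
  apply/polyP => k; rewrite coef_take_poly !coef_poly.
  by case: ltnP => // /leq_trans ->.
have [h ->] : exists h, f \Po ('X + c%:P)
    = f \Po ('X + c'%:P) + ('X^(i.+1) * w)%:P * h.
  elim/poly_ind: f => [|p a [h hE]].
    by exists 0; rewrite !comp_poly0 mulr0 addr0.
  exists (h * ('X + c%:P) + (p \Po ('X + c'%:P))).
  by rewrite !comp_poly_MXaddC hE cE !polyCD; ring.
by rewrite coefD coefCM coefD -mulrA coefXnM ltnSn addr0.
Qed.

(* The minimum of i + t j over the indices with a_ij != 0; for f != 0 and
   t > 0 the infimum is attained. *)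
Definition quasi_val xi t f : R :=
  inf [set s | exists i j : nat,
         quasi_coef xi f i j != 0 /\ s = i%:R + t * j%:R].

(* A maximum: the values are bounded by t * d and lie in a discrete set. *)
Definition mu xi t (d : nat) : R :=
  sup [set s | exists f, [/\ f != 0, total_degree_le d f & s = quasi_val xi t f]].

Definition mu_hat_at xi t : R :=
  lim ((fun d : nat => mu xi t d / d%:R) @ \oo).

End Valuation.

Section VeryGeneral.
Variable R : realType.

Definition zariski_closed (n : nat) (Z : set ('I_n -> R[i])) : Prop :=
  exists S : set (mpoly.mpoly n R[i]),
    Z = [set a | forall p, S p -> mpoly.meval a p = 0].

(* The n-jet of a series without constant term: (xi_1, ..., xi_n). *)
Definition jet (n : nat) (xi : nat -> R[i]) : 'I_n -> R[i] :=
  fun i => xi i.+1.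

Definition for_very_general_series (P : (nat -> R[i]) -> Prop) : Prop :=
  exists n (Z : nat -> set ('I_n -> R[i])),
    (forall k, zariski_closed (Z k) /\ Z k <> setT) /\
    (forall xi, xi 0%N = 0 -> (forall k, ~ Z k (jet xi)) -> P xi).

(* The common value of mu_hat_at xi t at the very general series xi. *)
Definition mu_hat (t : R) : R :=
  get [set m | for_very_general_series (fun xi => mu_hat_at xi t = m)].

End VeryGeneral.

(* Main.v *)
Require Import Defs.
From mathcomp Require Import all_boot all_order all_algebra complex.
From mathcomp Require Import all_classical all_reals all_analysis.
From mathcomp Require Import lra.
From mathcomp.multinomials Require mpoly.
Import (canonicals, coercions) mpoly.
Import Order.TTheory GRing.Theory Num.Theory.
Import numFieldNormedType.Exports.
Local Open Scope classical_set_scope.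
Local Open Scope ring_scope.

(** The Lipschitz bound holds for each series [xi] separately; genericity only
serves to compare two values of [t] on one and the same series.

Fix [xi] and [1 <= t <= s]. Writing [f = \sum a_ij x^i (y - xi)^j], the value
at [t] is the minimum of [i + t j] over the support. It is nondecreasing in [t],
and since [j] is at most the degree [d] of [f], it grows by at most [(s - t) d]
between [t] and [s] ([quasi_val_mono], [quasi_val_lipschitz]). The maximum over
[f] and the quotient by [d] turn this into [0 <= mu_hat(s) - mu_hat(t) <= s - t]
at [xi], provided that the limits exist. They do by Fekete's lemma
([superadditive_cvg]): [mu_d] is superadditive in [d] because the value of a
product is at least the sum of the values ([muD]), and it is at most [t d].

It remains to see that [mu_hat(t)] is the value at very general series
([mu_hat_very_general]) and that two very general conditions have a common
solution ([very_general_meet]).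

For the first point, the condition [v(f) >= s] depends on [xi] only modulo [x^n]
for any [n >= t]: a change of [xi] by [x^n w] moves weight only upwards, because
[x^n] weighs at least as much as [y] ([weight_ge_recenter]). So for a finite set
[L] of exponents, the existence of a nonzero [f] of degree at most [d] whose
coefficients [a_ij], [(i, j)] in [L], vanish is the solvability of a linear
system whose matrix is polynomial in the [n]-jet of [xi]; outside one proper
hypersurface, a solution exists only if it exists for all jets
([generic_kernel]). As there are countably many pairs [(d, L)], all [mu_d] are
constant at very general [xi].

For the second point, countably many polynomials that are each nonzero somewhere
are made simultaneously nonzero by fixing the coordinates one at a time: each
step must avoid the roots of countably many nonzero univariate polynomials,
which is possible since the field is uncountable ([exists_generic_series]). *)

Set Implicit Arguments.
Unset Strict Implicit.
Unset Printing Implicit Defensive.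

(** * The weight filtration and the valuation *)

Section Weight.
Context {R : realType}.
Implicit Types (xi : nat -> R[i]) (f g : {poly {poly R[i]}}) (t s : R).

Definition weight_ge t s g : Prop :=
  forall i j : nat, g`_j`_i != 0 -> s <= i%:R + t * j%:R.

Lemma weight_geD t s f g :
  weight_ge t s f -> weight_ge t s g -> weight_ge t s (f + g).
Proof.
move=> wf wg i j; rewrite !coefD => nz.
have [/eqP fz|/wf//] := boolP (f`_j`_i == 0).
by apply: wg; move: nz; rewrite fz add0r.
Qed.

Lemma weight_geM t s s' f g :
  weight_ge t s f -> weight_ge t s' g -> weight_ge t (s + s') (f * g).
Proof.
move=> wf wg i j nz; apply: contraT => lts; move/negP: nz; case; apply/eqP.
rewrite coefM coef_sum big1// => k _; rewrite coefM big1// => l _.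
have [->|/wf hf] := eqVneq f`_k`_l 0; first by rewrite mul0r.
have [->|/wg hg] := eqVneq g`_(j - k)`_(i - l) 0; first by rewrite mulr0.
case/negP: lts; apply: le_trans (lerD hf hg) _.
rewrite addrACA -mulrDr -!natrD !subnKC//; by rewrite -ltnS.
Qed.

Lemma weight_ge0 t s : weight_ge t s 0.
Proof. by move=> i j; rewrite !coef0 eqxx. Qed.

Lemma weight_ge_sum t s (I : Type) (r : seq I) (F : I -> {poly {poly R[i]}}) :
  (forall k, weight_ge t s (F k)) -> weight_ge t s (\sum_(k <- r) F k).
Proof.
move=> wF; elim/big_ind : _ => //; [exact: weight_ge0|exact: weight_geD].
Qed.

Lemma weight_ge1 t : weight_ge t 0 1.
Proof.
move=> i j; rewrite coef1; case: j => [|j]; last by rewrite coef0 eqxx.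
by rewrite mulr0 addr0.
Qed.

Lemma weight_geX t s g n : weight_ge t s g -> weight_ge t (n%:R * s) (g ^+ n).
Proof.
move=> wg; elim: n => [|n IHn]; first by rewrite mul0r expr0; exact: weight_ge1.
by rewrite exprS -natr1 mulrDl mul1r addrC; exact: weight_geM.
Qed.

(** The substitution [y := y + x^n w] only adds terms of weight at least that of
[y], because [x^n] has weight [n >= t]. *)
Lemma weight_ge_shift t s f n (w : {poly R[i]}) : t <= n%:R ->
  weight_ge t s f -> weight_ge t s (f \Po ('X + ('X^n * w)%:P)).
Proof.
move=> letn wf; rewrite comp_polyE; apply: weight_ge_sum => k.
have wk : weight_ge t (s - t * (k : nat)%:R) (f`_k)%:P.
  move=> i j; rewrite coefC; case: j => [|j]; last by rewrite coef0 eqxx.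
  by move=> /wf; rewrite mulr0 addr0 lerBlDr.
have wX : weight_ge t t ('X + ('X^n * w)%:P).
  move=> i j; rewrite coefD coefX coefC.
  case: j => [|[|j]] /=; rewrite ?add0r ?addr0 ?coef0 ?eqxx//; last first.
    by rewrite mulr1 lerDr ler0n.
  rewrite coefXnM; case: ltnP => [_|leni _]; first by rewrite eqxx.
  by rewrite mulr0 addr0 (le_trans letn)// ler_nat.
rewrite -mul_polyC -(subrK (t * (k : nat)%:R) s); apply: weight_geM => //.
by rewrite mulrC; exact: weight_geX.
Qed.

(** The expansion of [f] around the truncated series: its coefficients of
[x]-degree below [n] are the [quasi_coef]; those beyond depend on the
truncation. *)
Definition recenter xi n f := f \Po ('X + (series_trunc xi n)%:P).

Lemma quasi_coef_recenter xi f i j n : (i < n)%N ->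
  quasi_coef xi f i j = (recenter xi n f)`_j`_i.
Proof. by move=> ltin; rewrite /recenter quasi_coef_trunc. Qed.

(** The truncations at [n] and at [m] differ by a multiple of [x^n], so the two
expansions are obtained from each other by the shift of [weight_ge_shift], in
both directions. *)
Lemma recenter_widen xi n m f : (n <= m)%N ->
  exists w, recenter xi m f = recenter xi n f \Po ('X + ('X^n * w)%:P)
    /\ recenter xi n f = recenter xi m f \Po ('X + ('X^n * - w)%:P).
Proof.
move=> lenm; exists (drop_poly n (series_trunc xi m)).
have cE : series_trunc xi m
    = series_trunc xi n + 'X^n * drop_poly n (series_trunc xi m).
  rewrite [LHS](esym (poly_take_drop n (series_trunc xi m))) mulrC.
  congr (_ + _); apply/polyP => k; rewrite coef_take_poly !coef_poly.
  by case: ltnP => // /leq_trans ->.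
split; rewrite /recenter -comp_polyA; congr (_ \Po _);
  rewrite comp_polyD comp_polyX comp_polyC -addrA -polyCD; congr (_ + _%:P).
  by rewrite addrC -cE.
by rewrite mulrN {2}cE addrC addrK.
Qed.

Lemma weight_ge_recenter xi t s f n m : t <= n%:R -> (n <= m)%N ->
  weight_ge t s (recenter xi n f) <-> weight_ge t s (recenter xi m f).
Proof.
move=> letn /(recenter_widen xi f)[w [e e']].
by split => wf; [rewrite e|rewrite e']; exact: weight_ge_shift.
Qed.

(** Truncation at [n >= t] suffices to decide whether the value is at least [s].
The passage is through a truncation beyond [s], whose spurious coefficients
have [x]-degree, hence weight, at least [s] already. *)
Lemma quasi_coef_geP xi t s f n : 0 <= t -> t <= n%:R ->
  (forall i j, quasi_coef xi f i j != 0 -> s <= i%:R + t * j%:R) <->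
  weight_ge t s (recenter xi n f).
Proof.
move=> t0 letn; have [N ltsN] : exists N : nat, s < N%:R.
  by exists (Num.bound `|s|); apply: le_lt_trans (ler_norm _) (archi_boundP _).
rewrite (@weight_ge_recenter _ _ _ _ n (maxn n N))// ?leq_maxl//.
split=> h i j nz; have [ltiN|leNi] := ltnP i (maxn n N).
- by apply: h; rewrite (@quasi_coef_recenter _ _ _ _ (maxn n N)).
- apply: le_trans (ltW ltsN) _; apply: le_trans (_ : i%:R <= _).
    by rewrite ler_nat (leq_trans _ leNi)// leq_maxr.
  by rewrite lerDl mulr_ge0.
- by apply: h; rewrite -(@quasi_coef_recenter _ _ _ _ (maxn n N)).
- apply: le_trans (ltW ltsN) _; apply: le_trans (_ : i%:R <= _).
    by rewrite ler_nat (leq_trans _ leNi)// leq_maxr.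
  by rewrite lerDl mulr_ge0.
Qed.

(** Since [y + xi] is monic in [y], recentering keeps the coefficient of the top
power of [y]. This one coefficient bounds the value from above and shows that
the set whose infimum is the value is nonempty. *)
Lemma quasi_coef_lead xi f i :
  quasi_coef xi f i (size f).-1 = (lead_coef f)`_i.
Proof.
rewrite /quasi_coef; set q := 'X + _.
have sq : size q = 2%N by rewrite size_XaddC.
rewrite -(size_comp_poly2 f sq) -lead_coefE lead_coef_comp ?sq//.
by rewrite /q lead_coefDl ?size_polyX ?size_polyC ?lead_coefX ?expr1n ?mulr1//; case: eqP.
Qed.

(** The bound on [j] is what turns a change of [t] into a change of value linear
in the degree. *)
Lemma quasi_coef_deg_y xi f d i j : total_degree_le d f ->
  quasi_coef xi f i j != 0 -> (j <= d)%N.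
Proof.
move=> df; rewrite /quasi_coef; set q := 'X + _.
have sq : size q = 2%N by rewrite size_XaddC.
have [->|f0] := eqVneq f 0; first by rewrite comp_poly0 !coef0 eqxx.
move=> nz; have : (j < size (f \Po q))%N.
  by rewrite ltnNge; apply: contra nz => /leq_sizeP ->//; rewrite coef0.
rewrite (size_comp_poly2 f sq) => ltj.
have l0 : lead_coef f != 0 by rewrite lead_coef_eq0.
have := df (size (lead_coef f)).-1 (size f).-1.
rewrite -lead_coefE -lead_coefE lead_coef_eq0 => /(_ l0) h.
apply: leq_trans (leq_trans (leq_addl _ _) h).
by rewrite -ltnS prednK// (leq_ltn_trans _ ltj).
Qed.

Lemma exists_quasi_coef xi f d : f != 0 -> total_degree_le d f ->
  exists i j, quasi_coef xi f i j != 0 /\ (i + j <= d)%N.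
Proof.
move=> f0 df; exists (size (lead_coef f)).-1, (size f).-1.
rewrite quasi_coef_lead -lead_coefE !lead_coef_eq0; split=> //.
by apply: df; rewrite -lead_coefE -lead_coefE !lead_coef_eq0.
Qed.

Lemma total_degree_exists f : exists d, total_degree_le d f.
Proof.
exists (\sum_(j < size f) size (f`_j)%R + size f)%N => i j nz.
have ltj : (j < size f)%N.
  by rewrite ltnNge; apply: contra nz => /leq_sizeP ->//; rewrite coef0.
have lti : (i < size (f`_j)%R)%N.
  by rewrite ltnNge; apply: contra nz => /leq_sizeP ->.
apply: leq_add; last exact: ltnW.
by rewrite (bigD1 (Ordinal ltj))//= (leq_trans (ltnW lti))// leq_addr.
Qed.

Definition quasi_values xi t f :=
  [set s | exists i j : nat, quasi_coef xi f i j != 0 /\ s = i%:R + t * j%:R].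

Lemma quasi_values_has_inf xi t f : 0 <= t -> f != 0 ->
  has_inf (quasi_values xi t f).
Proof.
move=> t0 f0; have [d df] := total_degree_exists f.
have [i [j [nz _]]] := exists_quasi_coef xi f0 df.
split; first by exists (i%:R + t * j%:R), i, j.
by exists 0 => _ [k [l [_ ->]]]; rewrite addr_ge0 ?mulr_ge0.
Qed.

Lemma quasi_val_le xi t f i j : 0 <= t -> f != 0 -> quasi_coef xi f i j != 0 ->
  quasi_val xi t f <= i%:R + t * j%:R.
Proof.
move=> t0 f0 nz; have [_ lb] := quasi_values_has_inf xi t0 f0.
by apply: ge_inf => //; exists i, j.
Qed.

Lemma quasi_val_geP xi t s f : 0 <= t -> f != 0 ->
  s <= quasi_val xi t f <->
  (forall i j, quasi_coef xi f i j != 0 -> s <= i%:R + t * j%:R).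
Proof.
move=> t0 f0; split=> [les i j nz|h].
  by apply: le_trans les _; exact: quasi_val_le.
have [ne _] := quasi_values_has_inf xi t0 f0.
by apply: lb_le_inf => // _ [i [j [nz ->]]]; exact: h.
Qed.

Lemma quasi_val_weight xi t s f n : 0 <= t -> t <= n%:R -> f != 0 ->
  s <= quasi_val xi t f <-> weight_ge t s (recenter xi n f).
Proof.
move=> t0 letn f0.
exact: iff_trans (quasi_val_geP xi s t0 f0) (quasi_coef_geP xi s f t0 letn).
Qed.

Lemma quasi_val_ge0 xi t f : 0 <= t -> f != 0 -> 0 <= quasi_val xi t f.
Proof. by move=> t0 f0; apply/quasi_val_geP => // i j _; rewrite addr_ge0 ?mulr_ge0. Qed.

Lemma quasi_valM xi t f g : 0 <= t -> f != 0 -> g != 0 ->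
  quasi_val xi t f + quasi_val xi t g <= quasi_val xi t (f * g).
Proof.
move=> t0 f0 g0; have letn := ltW (archi_boundP t0).
apply/(quasi_val_weight _ _ t0 letn); first by rewrite mulf_neq0.
by rewrite /recenter comp_polyM; apply: weight_geM;
   apply/(quasi_val_weight _ _ t0 letn).
Qed.

Lemma quasi_val_le_degree xi t f d : 1 <= t -> f != 0 -> total_degree_le d f ->
  quasi_val xi t f <= t * d%:R.
Proof.
move=> t1 f0 df; have t0 : 0 <= t by rewrite (le_trans ler01).
have [i [j [nz le]]] := exists_quasi_coef xi f0 df.
apply: le_trans (quasi_val_le t0 f0 nz) _.
apply: le_trans (_ : t * (i + j)%:R <= _); last by rewrite ler_wpM2l ?ler_nat.
by rewrite natrD mulrDr lerD2r ler_peMl.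
Qed.

Lemma quasi_val_mono xi t s f : 0 <= t -> t <= s -> f != 0 ->
  quasi_val xi t f <= quasi_val xi s f.
Proof.
move=> t0 lets f0; have s0 := le_trans t0 lets.
apply/quasi_val_geP => // i j nz.
by apply: le_trans (quasi_val_le t0 f0 nz) _; rewrite lerD2l ler_wpM2r.
Qed.

Lemma quasi_val_lipschitz xi t s f d : 0 <= t -> t <= s -> f != 0 ->
  total_degree_le d f ->
  quasi_val xi s f <= quasi_val xi t f + (s - t) * d%:R.
Proof.
move=> t0 lets f0 df; have s0 := le_trans t0 lets.
rewrite -lerBlDr; apply/quasi_val_geP => // i j nz; rewrite lerBlDr.
apply: le_trans (quasi_val_le s0 f0 nz) _.
rewrite -addrA lerD2l -lerBlDl -mulrBl ler_wpM2l ?subr_ge0// ler_nat.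
exact: quasi_coef_deg_y nz.
Qed.

End Weight.

(** * The maxima [mu_d] and their limit *)

(** Fekete's lemma, in the form with explicit error
[a n / n >= a m / m - a m / n], obtained from [a n >= (n %/ m) a m]. *)
Lemma superadditive_cvg (R : realType) (a : nat -> R) (C : R) :
  (forall n m, a n + a m <= a (n + m)%N) -> (forall n, 0 <= a n) ->
  (forall n, a n <= C * n%:R) -> cvgn (fun n => a n / n%:R).
Proof.
move=> aD a0 aC; pose E := [set a n / n%:R | n in [set n | (0 < n)%N]].
have C0 : 0 <= C by have := le_trans (a0 1%N) (aC 1%N); rewrite mulr1.
have le_C n : a n / n%:R <= C.
  case: n => [|n]; first by rewrite invr0 mulr0.
  by rewrite ler_pdivrMr ?ltr0n.
have supE : has_sup E.
  split; first by exists (a 1%N / 1%:R), 1%N.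
  by exists C => _ [n _ <-].
have a_mul q m : q%:R * a m <= a (q * m)%N.
  elim: q => [|q IHq]; first by rewrite mul0r.
  by rewrite mulSn -natr1 mulrDl mul1r addrC (le_trans _ (aD _ _))// lerD2l.
apply/cvg_ex; exists (sup E); apply/cvgrPdist_le => e e0.
have [_ [m m0 <-] ltm] := @sup_adherent _ E (e / 2) (divr_gt0 e0 (ltr0Sn _ 1)) supE.
near=> n.
have n0 : (0 < n)%N by near: n; exists 1%N.
have le_sup : a n / n%:R <= sup E by apply: ub_le_sup; [case: supE|exists n].
have small : a m / n%:R <= e / 2.
  rewrite ler_pdivrMr ?ltr0n// mulrC -ler_pdivrMr ?divr_gt0//.
  by near: n; exact: nbhs_infty_ger.
(* From [n < (n %/ m + 1) m]. *)
have key : a m / m%:R - a m / n%:R <= a n / n%:R.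
  have nR : 0 < n%:R :> R by rewrite ltr0n.
  have mR : 0 < m%:R :> R by rewrite ltr0n.
  rewrite -(ler_pM2r nR) mulrBl !divfK ?gt_eqF//.
  have : (n %/ m)%:R * a m <= a n.
    apply: le_trans (a_mul _ _) _; rewrite [in leRHS](divn_eq n m).
    by apply: le_trans (aD _ _); rewrite lerDl.
  apply: le_trans; rewrite lerBlDr -{3}[a m]mul1r -mulrDl natr1.
  rewrite -mulrA mulrC ler_wpM2r// mulrC ler_pdivrMr//.
  by rewrite -natrM ler_nat ltnW// ltn_ceil.
rewrite ger0_norm ?subr_ge0//; lra.
Unshelve. all: by end_near.
Qed.

Section Mu.
Context {R : realType}.
Implicit Types (xi : nat -> R[i]) (f g : {poly {poly R[i]}}) (t s : R).

Lemma total_degree_leM d e f g : total_degree_le d f -> total_degree_le e g ->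
  total_degree_le (d + e) (f * g).
Proof.
move=> df eg i j nz; apply: contraT; rewrite -ltnNge => lts.
move/negP: nz; case; apply/eqP.
rewrite coefM coef_sum big1// => k _; rewrite coefM big1// => l _.
have [->|/df hf] := eqVneq f`_k`_l 0; first by rewrite mul0r.
have [->|/eg hg] := eqVneq g`_(j - k)`_(i - l) 0; first by rewrite mulr0.
move: lts; rewrite ltnNge => /negP[]; apply: leq_trans (leq_add hf hg).
by rewrite addnACA !subnKC// -ltnS.
Qed.

Definition mu_values xi t (d : nat) :=
  [set s | exists f, [/\ f != 0, total_degree_le d f & s = quasi_val xi t f]].

Lemma mu_values1 xi t d : mu_values xi t d (quasi_val xi t 1).
Proof.
exists 1; split=> //; first exact: oner_neq0.
move=> i j; rewrite coef1; case: j => [|j]; last by rewrite coef0 eqxx.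
by rewrite coef1; case: i => //= i; rewrite eqxx.
Qed.

Lemma mu_has_sup xi t d : 1 <= t -> has_sup (mu_values xi t d).
Proof.
move=> t1; split; first by exists (quasi_val xi t 1); exact: mu_values1.
by exists (t * d%:R) => _ [f [f0 df ->]]; exact: quasi_val_le_degree.
Qed.

Lemma quasi_val_le_mu xi t d f : 1 <= t -> f != 0 -> total_degree_le d f ->
  quasi_val xi t f <= mu xi t d.
Proof.
move=> t1 f0 df; have [_ ub] := mu_has_sup xi d t1.
by apply: ub_le_sup => //; exists f.
Qed.

Lemma mu_le xi t d (m : R) : 1 <= t ->
  (forall f, f != 0 -> total_degree_le d f -> quasi_val xi t f <= m) ->
  mu xi t d <= m.
Proof.
move=> t1 h; have [ne _] := mu_has_sup xi d t1.
by apply: ge_sup => // _ [f [f0 df ->]]; exact: h.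
Qed.

Lemma mu_ge0 xi t d : 1 <= t -> 0 <= mu xi t d.
Proof.
move=> t1; have t0 : 0 <= t by rewrite (le_trans ler01).
have [_ ub] := mu_has_sup xi d t1.
apply: le_trans (ub_le_sup ub (mu_values1 xi t d)).
by apply: quasi_val_ge0 => //; exact: oner_neq0.
Qed.

Lemma muD xi t d e : 1 <= t -> mu xi t d + mu xi t e <= mu xi t (d + e).
Proof.
move=> t1; have t0 : 0 <= t by rewrite (le_trans ler01).
rewrite -lerBrDr; apply: mu_le => // f f0 df.
rewrite lerBrDr -lerBrDl; apply: mu_le => // g g0 eg.
rewrite lerBrDl (le_trans (quasi_valM _ t0 f0 g0))//.
by apply: quasi_val_le_mu; rewrite ?mulf_neq0//; exact: total_degree_leM.
Qed.

(** The value [lim] is meaningful only because of this convergence. *)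
Lemma mu_hat_at_cvg xi t : 1 <= t -> cvgn (fun d => mu xi t d / d%:R).
Proof.
move=> t1; apply: (@superadditive_cvg _ _ t) => [n m|n|n].
- exact: muD.
- exact: mu_ge0.
- by apply: mu_le => // f f0 df; exact: quasi_val_le_degree.
Qed.

Lemma mu_hat_at_mono xi t s : 1 <= t -> t <= s ->
  mu_hat_at xi t <= mu_hat_at xi s.
Proof.
move=> t1 lets; have s1 := le_trans t1 lets.
apply: ler_lim; [exact: mu_hat_at_cvg|exact: mu_hat_at_cvg|].
apply: nearW => d; rewrite ler_wpM2r// ?invr_ge0//.
apply: mu_le => // f f0 df; apply: le_trans (quasi_val_le_mu _ s1 f0 df).
by apply: quasi_val_mono => //; rewrite (le_trans ler01).
Qed.

Lemma mu_hat_at_lipschitz xi t s : 1 <= t -> t <= s ->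
  mu_hat_at xi s <= mu_hat_at xi t + (s - t).
Proof.
move=> t1 lets; have s1 := le_trans t1 lets.
have ct := @mu_hat_at_cvg xi t t1; have cs := @mu_hat_at_cvg xi s s1.
have cst : (fun d : nat => mu xi t d / d%:R + (s - t)) @ \oo -->
    mu_hat_at xi t + (s - t) by apply: cvgD => //; exact: cvg_cst.
rewrite -(cvg_lim _ cst)//; apply: ler_lim => //; first by apply/cvg_ex; eexists; exact: cst.
exists 1%N => // d /= d0; have dR : 0 < d%:R :> R by rewrite ltr0n.
rewrite ler_pdivrMr// mulrDl divfK ?gt_eqF//.
apply: mu_le => // f f0 df.
apply: le_trans (_ : quasi_val xi t f + (s - t) * d%:R <= _).
  by apply: quasi_val_lipschitz => //; rewrite (le_trans ler01).
by rewrite lerD2r quasi_val_le_mu.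
Qed.

End Mu.

(** * Linear systems depending polynomially on parameters *)

Section Generic.
Context {K : fieldType}.

Lemma meval_line n (p : mpoly.mpoly n K) (a : nat -> K) (m : nat) :
  exists q : {poly K}, forall u,
    q.[u] = mpoly.meval (fun j : 'I_n => if j == m :> nat then u else a j) p.
Proof.
exists (\sum_(e <- mpoly.msupp p) (mpoly.mcoeff e p)%:P *
  \prod_(j < n) (if j == m :> nat then 'X else (a j)%:P) ^+ e j) => u.
rewrite mpoly.mevalE horner_sum; apply: eq_bigr => e _.
rewrite hornerM hornerC horner_prod; congr (_ * _); apply: eq_bigr => j _.
by rewrite horner_exp; case: ifP => _; rewrite ?hornerX ?hornerC.
Qed.

(** If some specialization has full column rank, then [P] is a maximal minor that
is nonzero there: where [P] does not vanish the kernel is trivial. Otherwise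
every specialization has a nontrivial kernel and [P = 1] works. *)
Lemma generic_kernel n l m (B : 'M[mpoly.mpoly n K]_(l, m)) :
  exists P : mpoly.mpoly n K, (exists a, mpoly.meval a P != 0) /\
    forall a, mpoly.meval a P != 0 ->
    (exists v : 'cV_m, v != 0 /\ map_mx (mpoly.meval a) B *m v = 0) ->
    forall b, exists v : 'cV_m, v != 0 /\ map_mx (mpoly.meval b) B *m v = 0.
Proof.
have [[b full]|nfull] := pselect (exists b, row_full (map_mx (mpoly.meval b) B)).
  pose rows := fullrankfun full.
  have evalP a : mpoly.meval a (\det (rowsub rows B))
      = \det (rowsub rows (map_mx (mpoly.meval a) B)).
    by rewrite -det_map_mx map_mxsub.
  exists (\det (rowsub rows B)); split.
    by exists b; rewrite evalP -unitfE -unitmxE fullrowsub_unit.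
  move=> a; rewrite evalP -unitfE -unitmxE => unitB [v [/eqP v0 Bv]] b'.
  case: v0; rewrite -[v](mulKmx unitB) mul_rowsub_mx Bv.
  by rewrite (_ : rowsub _ 0 = 0) ?mulmx0//; apply/matrixP => i j; rewrite !mxE.
exists 1; split; first by exists (fun=> 0); rewrite rmorph1 oner_neq0.
move=> _ _ _ b; have nf : ~~ row_full (map_mx (mpoly.meval b) B).
  by apply/negP => h; apply: nfull; exists b.
have : cokermx (map_mx (mpoly.meval b) B) != 0.
  by rewrite -mxrank_eq0 mxrank_coker subn_eq0 -ltnNge ltn_neqAle [_ != _]nf rank_leq_col.
case/matrix0Pn => i [j nz].
exists (col j (cokermx (map_mx (mpoly.meval b) B))); split.
  by apply/eqP => /matrixP /(_ i ord0)/eqP; rewrite mxE [in X in _ == X]mxE; apply/negP.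
by rewrite colE mulmxA mulmx_coker mul0mx.
Qed.

End Generic.

(** * Existence of very general series *)

Section GenericSeries.
Context {R : realType}.

(** Already on the real line the excluded points form a countable set, hence a
set of Lebesgue measure zero. *)
Lemma avoid_countable_roots (I : countType) (q : I -> {poly R[i]}) :
  (forall k, q k != 0) -> exists u, forall k, (q k).[u] != 0.
Proof.
move=> q0; apply: contrapT => /forallNP none.
pose roots k := [set x : R | (q k).[x%:C%C] = 0].
have croots : countable (\bigcup_(k in [set: I]) roots k).
  apply: bigcup_countable => // k _; apply: finite_set_countable.
  have [r qE] := closed_field_poly_normal (q k).
  apply: (@sub_finite_set _ _ [set complex.Re z | z in [set` r]]).
    move=> x /eqP; rewrite qE hornerZ mulf_eq0 lead_coef_eq0 (negbTE (q0 k)) /=.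
    rewrite -[_ == 0]/(root _ _) root_prod_XsubC => xr.
    by exists x%:C%C.
  by apply: finite_image; exact: finite_seq.
have full : \bigcup_(k in [set: I]) roots k = setT.
  apply/seteqP; split=> // x _; apply: contrapT => nx; apply: (none x%:C%C) => k.
  by apply/eqP => h; apply: nx; exists k.
have := countable_lebesgue_measure0 croots; rewrite full => h0.
have : (lebesgue_measure `[0%R, 1%R] <= lebesgue_measure [set: R])%E.
  by apply: le_measure; rewrite ?inE.
by rewrite h0 lebesgue_measure_itv /= lte_fin ltr01 oppr0 adde0 lee_fin leNgt ltr01.
Qed.

(** The coordinates are fixed one after the other. The invariant is that after
[m] steps each polynomial still has a point of nonvanishing, depending on the
polynomial, whose first [m] coordinates are the ones already fixed. *)
Lemma exists_generic_series (I : countType) (n : I -> nat)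
    (p : forall k, mpoly.mpoly (n k) R[i]) (N : nat) :
  (forall k, (n k <= N)%N) -> (forall k, exists a, mpoly.meval a (p k) != 0) ->
  exists xi : nat -> R[i], xi 0%N = 0 /\
    forall k, mpoly.meval (jet xi) (p k) != 0.
Proof.
move=> leN p0.
suff H m : exists c : nat -> R[i], forall k, exists a : nat -> R[i],
    (forall i, (i < m)%N -> a i = c i) /\
    mpoly.meval (fun i : 'I_(n k) => a i) (p k) != 0.
  have [c hc] := H N; exists (fun k => if k is k'.+1 then c k' else 0).
  split=> // k; have [a [ac nz]] := hc k; congr (_ != 0): nz.
  by congr (mpoly.meval _ _); apply/funext => i; rewrite ac// (leq_trans _ (leN k)).
elim: m => [|m [c hc]].
  exists (fun=> 0) => k; have [a nz] := p0 k.
  exists (fun j => if insub j is Some i then a i else 0); split=> //.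
  congr (_ != 0): nz; congr (mpoly.meval _ _); apply/funext => i.
  by rewrite valK.
have [a ha] := choice hc.
(* The restriction of [p k] to the line through [a k] in direction [m]. *)
have [q qE] := choice (fun k => meval_line (p k) (a k) m).
have [k|u hu] := @avoid_countable_roots _ q.
  have [_ nz] := ha k; apply: contraNneq nz => q0.
  have := qE k (a k m); rewrite q0 horner0 => ->.
  apply/eqP; congr (mpoly.meval _ _); apply/funext => i.
  by case: eqP => // ->.
exists (fun i => if i == m then u else c i) => k.
exists (fun i => if i == m then u else a k i); split; last by rewrite -qE.
move=> i; case: eqP => // /eqP im; rewrite ltnS leq_eqVlt (negbTE im) /=.
by have [+ _] := ha k; apply.
Qed.

Lemma very_general_nonvanishing n (Z : set ('I_n -> R[i])) :
  zariski_closed Z -> Z <> setT ->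
  exists p : mpoly.mpoly n R[i], (exists a, mpoly.meval a p != 0) /\
    forall a, mpoly.meval a p != 0 -> ~ Z a.
Proof.
move=> [S ->]; rewrite -subTset => /existsNP[a /not_implyP[_]].
move=> /existsNP[p /not_implyP[Sp /eqP nz]].
by exists p; split; [exists a|move=> b nb /(_ p Sp) /eqP; exact/negP].
Qed.

(** The two conditions may concern jets of different orders. *)
Lemma very_general_meet (P Q : (nat -> R[i]) -> Prop) :
  for_very_general_series P -> for_very_general_series Q ->
  exists xi, P xi /\ Q xi.
Proof.
move=> [n [Z [hZ hP]]] [n' [Z' [hZ' hQ]]].
have [p hp] := choice (fun k => very_general_nonvanishing (hZ k).1 (hZ k).2).
have [p' hp'] := choice (fun k => very_general_nonvanishing (hZ' k).1 (hZ' k).2).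
pose dim (k : nat + nat) := if k is inl _ then n else n'.
pose eqn (k : nat + nat) : mpoly.mpoly (dim k) R[i] :=
  match k with inl i => p i | inr i => p' i end.
have [k|k|xi [xi0 nz]] := @exists_generic_series _ dim eqn (maxn n n').
- by case: k => k /=; rewrite ?leq_maxl ?leq_maxr.
- by case: k => k /=; [case: (hp k)|case: (hp' k)].
exists xi; split; [apply: hP|apply: hQ] => // k.
  by apply: (hp k).2; exact: nz (inl k).
by apply: (hp' k).2; exact: nz (inr k).
Qed.

End GenericSeries.

(** * Generic constancy of [mu_d] *)

Section FiniteSupport.
Context {K : fieldType}.
Variable ms : seq (nat * nat).
Implicit Type f : {poly {poly K}}.

Definition support_in f := forall i j : nat, f`_j`_i != 0 -> (i, j) \in ms.

Definition xy_monomial (L : nzRingType) (u : nat * nat) : {poly {poly L}} :=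
  ('X^(u.1))%:P * 'X^(u.2).

Definition poly_of_col (v : 'cV[K]_(size ms)) : {poly {poly K}} :=
  \sum_r ((v r 0)%:P)%:P * xy_monomial K (nth (0, 0)%N ms r).

Lemma coef_poly_of_col v i j :
  (poly_of_col v)`_j`_i = \sum_r v r 0 * (nth (0, 0)%N ms r == (i, j))%:R.
Proof.
rewrite !coef_sum; apply: eq_bigr => r _; rewrite 2!coefCM; congr (_ * _).
case: (nth (0, 0)%N ms r) => p q; rewrite /xy_monomial coefCM coefXn xpair_eqE.
rewrite (eq_sym p) (eq_sym q) andbC; case: (j == q) => /=.
  by rewrite mulr1 coefXn.
by rewrite mulr0 coef0.
Qed.

Hypothesis uniq_ms : uniq ms.

Lemma coef_poly_of_col_nth v (r : 'I_(size ms)) :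
  (poly_of_col v)`_(nth (0, 0)%N ms r).2`_(nth (0, 0)%N ms r).1 = v r 0.
Proof.
rewrite coef_poly_of_col -surjective_pairing (bigD1 r)//= eqxx mulr1.
rewrite big1 ?addr0// => s sr; rewrite nth_uniq// -val_eqE in sr *.
by rewrite (negbTE sr) mulr0.
Qed.

Lemma poly_of_col_eq0 v : poly_of_col v = 0 -> v = 0.
Proof.
move=> v0; apply/matrixP => r k; rewrite ord1 -coef_poly_of_col_nth v0 mxE.
by rewrite !coef0.
Qed.

Lemma poly_of_col_support v : support_in (poly_of_col v).
Proof.
move=> i j; rewrite coef_poly_of_col; apply: contraR => nin.
rewrite big1// => r _; case: eqP => [e|_]; last by rewrite mulr0.
by case/negP: nin; rewrite -e mem_nth.
Qed.

Lemma support_inP f : support_in f -> exists v, f = poly_of_col v.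
Proof.
move=> sf; pose v := \col_(r < size ms)
  f`_(nth (0, 0)%N ms r).2`_(nth (0, 0)%N ms r).1.
exists v; apply/polyP => j; apply/polyP => i.
have [/(nthP (0, 0)%N)[r ltr rE]|nin] := boolP ((i, j) \in ms).
  by have := coef_poly_of_col_nth v (Ordinal ltr); rewrite mxE /= rE.
have [->|/(@poly_of_col_support v)] := eqVneq (poly_of_col v)`_j`_i 0.
  by apply/eqP; apply: contraNT nin => /sf.
by rewrite (negbTE nin).
Qed.

End FiniteSupport.

Section VeryGeneralMu.
Context {R : realType}.
Implicit Types (xi : nat -> R[i]) (t s : R) (f : {poly {poly R[i]}}).

(** For fixed [d], the pairs of a list [L] are exponents [(i, j)]; a lower bound
on the value amounts to the vanishing of finitely many coefficients, and
countably many lists cover all values of [t] and of the bound. *)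
Definition solvable d (L : seq (nat * nat)) n xi := exists f,
  [/\ f != 0, total_degree_le d f &
      forall u, u \in L -> (recenter xi n f)`_u.2`_u.1 = 0].

(** The truncation [\sum_(1 <= k <= n) X_k x^k] with indeterminate coefficients;
the variable of index [k < n] stands for the coefficient of [x^(k+1)]. *)
Definition universal_trunc n : {poly mpoly.mpoly n R[i]} :=
  \sum_(k < n) mpoly.mpolyX R[i] (mpoly.mnm1 k) *: 'X^(k.+1).

Lemma universal_truncE n xi : xi 0%N = 0 ->
  map_poly (mpoly.meval (jet xi)) (universal_trunc n) = series_trunc xi n.+1.
Proof.
move=> xi0; rewrite /series_trunc poly_def big_ord_recl xi0 scale0r add0r.
rewrite rmorph_sum; apply: eq_bigr => k _ /=.
by rewrite map_polyZ map_polyXn /= mpoly.mevalXU.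
Qed.

Definition triangle d :=
  [seq u <- [seq (i, j) | i <- iota 0 d.+1, j <- iota 0 d.+1] | u.1 + u.2 <= d]%N.

Arguments triangle : simpl never.

Lemma uniq_triangle d : uniq (triangle d).
Proof.
by rewrite filter_uniq// allpairs_uniq ?iota_uniq// => -[? ?] [? ?].
Qed.

Lemma mem_triangle d i j : ((i, j) \in triangle d) = (i + j <= d)%N.
Proof.
rewrite mem_filter andb_idr// => le; apply/allpairsP; exists (i, j).
by rewrite !mem_iota /= !add0n !ltnS (leq_trans _ le) ?leq_addr// (leq_trans _ le) ?leq_addl.
Qed.

Lemma total_degree_triangle d f :
  total_degree_le d f <-> support_in (triangle d) f.
Proof. by split=> h i j /h; rewrite mem_triangle. Qed.

(** The matrix of the linear map sending the coefficients of [f] to the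
coefficients of exponents in [L] of its expansion around the universal
truncation. *)
Definition universal_system d (L : seq (nat * nat)) n :
    'M[mpoly.mpoly n R[i]]_(size L, size (triangle d)) :=
  \matrix_(c, r)
    (xy_monomial (mpoly.mpoly n R[i]) (nth (0, 0)%N (triangle d) r)
      \Po ('X + (universal_trunc n)%:P))`_(nth (0, 0)%N L c).2`_(nth (0, 0)%N L c).1.

Lemma universal_systemE d L n xi (v : 'cV_(size (triangle d))) c :
  xi 0%N = 0 ->
  (map_mx (mpoly.meval (jet xi)) (universal_system d L n) *m v) c 0
  = (recenter xi n.+1 (poly_of_col v))`_(nth (0, 0)%N L c).2`_(nth (0, 0)%N L c).1.
Proof.
move=> xi0; rewrite /recenter /poly_of_col linear_sum /= !coef_sum mxE.
apply: eq_bigr => r _; rewrite !mxE.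
rewrite [in RHS]comp_polyM [in RHS]comp_polyC 2![in RHS]coefCM [LHS]mulrC.
congr (_ * _); rewrite -universal_truncE//.
transitivity (map_poly (map_poly (mpoly.meval (jet xi)))
    (xy_monomial (mpoly.mpoly n R[i]) (nth (0, 0)%N (triangle d) r)
      \Po ('X + (universal_trunc n)%:P))
  )`_(nth (0, 0)%N L c).2`_(nth (0, 0)%N L c).1; first by rewrite !coef_map.
rewrite map_comp_poly rmorphD /= map_polyX map_polyC /=.
by rewrite /xy_monomial rmorphM /= map_polyC /= !map_polyXn.
Qed.

Lemma solvableP d L n xi : xi 0%N = 0 ->
  solvable d L n.+1 xi <-> exists v : 'cV_(size (triangle d)), v != 0 /\
    map_mx (mpoly.meval (jet xi)) (universal_system d L n) *m v = 0.
Proof.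
move=> xi0; split=> [[f [f0 df fL]]|[v [v0 Bv]]].
  have [v fE] := support_inP (uniq_triangle d) ((total_degree_triangle _ _).1 df).
  exists v; split.
    apply: contraNneq f0 => v0; rewrite fE v0 /poly_of_col big1// => r _.
    by rewrite mxE !polyC0 mul0r.
  apply/matrixP => c k; rewrite ord1 universal_systemE// -fE mxE.
  by apply: fL; rewrite mem_nth.
exists (poly_of_col v); split.
- by apply: contraNneq v0 => /(poly_of_col_eq0 (uniq_triangle d)) ->.
- exact/total_degree_triangle/poly_of_col_support.
- move=> _ /(nthP (0, 0)%N)[c ltc <-].
  by rewrite -(@universal_systemE d L n xi v (Ordinal ltc))// Bv mxE.
Qed.

(** Given [f] of value [s] at [xi], take for [L] the finitely many exponents of
weight less than [s]; a solution for [xi'] has value at least [s]. *)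
Lemma mu_le_solvable xi xi' t d n : 1 <= t -> t <= n%:R ->
  (forall L, solvable d L n xi -> solvable d L n xi') ->
  mu xi t d <= mu xi' t d.
Proof.
move=> t1 letn h; have t0 : 0 <= t by rewrite (le_trans ler01).
apply: mu_le => // f f0 df; set s := quasi_val xi t f.
have [M ltsM] : exists M : nat, s < M%:R.
  by exists (Num.bound `|s|); apply: le_lt_trans (ler_norm _) (archi_boundP _).
(* Since [t >= 1], a weight below [s < M] forces both exponents below [M]. *)
pose L := [seq u <- [seq (i, j) | i <- iota 0 M, j <- iota 0 M]
  | u.1%:R + t * u.2%:R < s].
have [|g [g0 dg gL]] := h L.
  exists f; split=> // -[i j]; rewrite mem_filter => /andP[/= lts _].
  apply/eqP; apply: contraTT lts => nz; rewrite -leNgt.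
  have /(quasi_val_weight xi s t0 letn f0) w : s <= s by [].
  exact: w nz.
apply: le_trans (quasi_val_le_mu xi' t1 g0 dg).
apply/(quasi_val_weight _ _ t0 letn g0) => i j; apply: contraNT; rewrite -ltNge => lts.
have ltM k : k%:R <= i%:R + t * j%:R -> (k < M)%N.
  by move=> lek; rewrite -(ltr_nat R) (le_lt_trans lek)// (lt_trans lts).
apply/eqP; apply: (gL (i, j)); rewrite mem_filter /= lts /=.
apply/allpairsP; exists (i, j); rewrite !mem_iota /= !add0n !ltM//.
  by rewrite (le_trans (_ : j%:R <= t * j%:R)) ?ler_peMl// lerDr.
by rewrite lerDl mulr_ge0.
Qed.

(** Where the polynomials [p (d, L)] do not vanish, solvability at one series
implies solvability at all, so two such series have the same [mu_d]. *)
Lemma mu_hat_at_very_general t : 1 <= t ->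
  exists m, for_very_general_series (fun xi => mu_hat_at xi t = m).
Proof.
move=> t1; have t0 : 0 <= t by rewrite (le_trans ler01).
pose n := Num.bound t.
have letn : t <= n.+1%:R.
  by rewrite (le_trans (ltW (archi_boundP t0)))// ler_nat.
have [p hp] := choice (fun u : nat * seq (nat * nat) =>
  generic_kernel (universal_system u.1 u.2 n)).
have [xi0 [xi00 nz0]] :=
  @exists_generic_series R _ _ p n (fun=> leqnn n) (fun u => (hp u).1).
have le_mu xi xi' d : xi 0%N = 0 -> xi' 0%N = 0 ->
    (forall u, mpoly.meval (jet xi) (p u) != 0) -> mu xi t d <= mu xi' t d.
  move=> x0 x0' nz; apply: (mu_le_solvable t1 letn) => L /(solvableP _ _ _ x0) sol.
  by apply/solvableP => //; exact: (hp (d, L)).2 sol _.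
exists (mu_hat_at xi0 t).
(* The pairs [(d, L)] are enumerated by [unpickle]; unused codes get [set0]. *)
exists n, (fun k => if unpickle k is Some u
  then [set a | mpoly.meval a (p u) = 0] else set0); split=> [k|xi x0 nZ].
  case: (unpickle k) => [u|]; split.
  - by exists [set p u]; apply/seteqP; split=> a /= h; [move=> _ ->|exact: h].
  - by have [a /eqP nz] := (hp u).1; move/seteqP => -[_ /(_ a I)].
  - exists [set 1]; apply/seteqP; split=> // a /(_ 1 erefl) /eqP.
    by rewrite rmorph1 oner_eq0.
  - by move/seteqP => -[_ /(_ (fun=> 0) I)].
have nz u : mpoly.meval (jet xi) (p u) != 0.
  by apply/eqP => h; apply: (nZ (pickle u)); rewrite pickleK.
have muE : mu xi t = mu xi0 t.
  apply/funext => d; apply/eqP; rewrite eq_le; apply/andP.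
  by split; apply: le_mu.
by rewrite /mu_hat_at muE.
Qed.

Lemma mu_hat_very_general t : 1 <= t ->
  for_very_general_series (fun xi => mu_hat_at xi t = mu_hat t).
Proof. by move=> /mu_hat_at_very_general h; exact: getPex h. Qed.

End VeryGeneralMu.


Theorem corollary2p20 (R : realType) :
  1.-lipschitz_[set t : R | 1 <= t] (@mu_hat R).
Proof.
suff le (t s : R) : 1 <= t -> t <= s -> `|mu_hat t - mu_hat s| <= s - t.
  move=> [t s] [/= t1 s1]; rewrite mul1r.
  have [lets|/ltW lest] := leP t s.
    by rewrite [leRHS]distrC [leRHS]ger0_norm ?subr_ge0// le.
  by rewrite distrC [leRHS]ger0_norm ?subr_ge0// le.
move=> t1 lets; have s1 := le_trans t1 lets.
have [xi [<- <-]] := very_general_meet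
  (mu_hat_very_general t1) (mu_hat_very_general s1).
rewrite distrC ger0_norm ?subr_ge0 ?mu_hat_at_mono// lerBlDl.
exact: mu_hat_at_lipschitz.
Qed.
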